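(* Let $v\ge4$. As formal power series in $y$, \[1+\sum_{d=1}^\infty \sum_{D \in \mathcal{D}_{v,d}(231,312)} x^{des(\pi_D)}y^d = \frac{1+x-yx(1+x)^{v-2}}{(1+x)\left(1-y(1+x)^{v-2}\right)}.\]
   Context: A diamond with $v$ vertices ($v\ge4$) is the poset with a least element, a greatest element, and $v-2$ pairwise incomparable middle elements (in a fixed left-to-right order) strictly between them. $\mathcal{D}_{v,d}$ is the set of labellings of $d$ diamonds (placed left to right) by $1,\dots,vd$, each label used once, such that in each diamond least label $<$ each middle label $<$ greatest label. For $D\in\mathcal{D}_{v,d}$, $\pi_D$ is the permutation obtained by reading the diamonds left to right and, within each diamond, the least element, then the middle elements left to right, then the greatest element. $\mathcal{D}_{v,d}(P)$ is the set of $D$ with $\pi_D$ avoiding every classical pattern in $P$. $des(\pi)$ is the number of $i$ with $\pi_i>\pi_{i+1}$. *)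

(* Defs.v *)
From HB Require Import structures.
From mathcomp Require Import all_boot all_order all_algebra.
From mathcomp Require Import boolp.

Set Implicit Arguments.
Unset Strict Implicit.
Unset Printing Implicit Defensive.

Import GRing.Theory.
Local Open Scope ring_scope.

Record fps (R : Type) := Fps { fps_coef : nat -> R }.

HB.instance Definition _ (R : Type) := gen_eqMixin (fps R).
HB.instance Definition _ (R : Type) := gen_choiceMixin (fps R).

Lemma fps_ext (R : Type) (f g : fps R) : fps_coef f =1 fps_coef g -> f = g.
Proof. by case: f g => f [g] /= fg; congr Fps; apply: funext. Qed.

Section FpsRing.
Variable R : comUnitRingType.
Implicit Types f g h : fps R.

Definition fps_zero : fps R := Fps (fun=> 0).
Definition fps_opp f : fps R := Fps (fun n => - fps_coef f n).
Definition fps_add f g : fps R := Fps (fun n => fps_coef f n + fps_coef g n).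

Fact fps_addA : associative fps_add.
Proof. by move=> f g h; apply: fps_ext => n /=; rewrite addrA. Qed.
Fact fps_addC : commutative fps_add.
Proof. by move=> f g; apply: fps_ext => n /=; rewrite addrC. Qed.
Fact fps_add0 : left_id fps_zero fps_add.
Proof. by move=> f; apply: fps_ext => n /=; rewrite add0r. Qed.
Fact fps_addN : left_inverse fps_zero fps_opp fps_add.
Proof. by move=> f; apply: fps_ext => n /=; rewrite addNr. Qed.

HB.instance Definition _ :=
  GRing.isZmodule.Build (fps R) fps_addA fps_addC fps_add0 fps_addN.

Definition fpsC (c : R) : fps R := Fps (fun n => if n == 0%N then c else 0).
Definition fps_mul f g : fps R :=
  Fps (fun n => \sum_(i < n.+1) fps_coef f i * fps_coef g (n - i)).

Definition fps_trunc m f : {poly R} := \poly_(i < m) fps_coef f i.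

Fact coef_fps_trunc m f n : (n < m)%N -> (fps_trunc m f)`_n = fps_coef f n.
Proof. by move=> nm; rewrite coef_poly nm. Qed.

Fact fps_mul_trunc m f g n : (n < m)%N ->
  fps_coef (fps_mul f g) n = (fps_trunc m f * fps_trunc m g)`_n.
Proof.
move=> nm; rewrite coefM /=; apply: eq_bigr => i _.
rewrite !coef_fps_trunc //; first exact: leq_ltn_trans (leq_subr _ _) nm.
by apply: leq_ltn_trans nm; rewrite -ltnS.
Qed.

Fact fps_mulC : commutative fps_mul.
Proof.
by move=> f g; apply: fps_ext => n; rewrite !(@fps_mul_trunc n.+1) // mulrC.
Qed.

Fact fps_mulA : associative fps_mul.
Proof.
move=> f g h; apply: fps_ext => n.
transitivity (fps_trunc n.+1 f * fps_trunc n.+1 g * fps_trunc n.+1 h)`_n.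
  rewrite -mulrA coefM; apply: eq_bigr => i _.
  rewrite coef_fps_trunc //; congr (_ * _).
  by rewrite -fps_mul_trunc // ltnS leq_subr.
rewrite coefM; apply: eq_bigr => i _.
rewrite -fps_mul_trunc //; congr (_ * _).
by rewrite coef_fps_trunc // ltnS leq_subr.
Qed.

Fact fps_mul1 : left_id (fpsC 1) fps_mul.
Proof.
move=> f; apply: fps_ext => n /=.
rewrite big_ord_recl /= mul1r subn0 big1 ?addr0 // => i _.
by rewrite mul0r.
Qed.

Fact fps_mulDl : left_distributive fps_mul fps_add.
Proof.
move=> f g h; apply: fps_ext => n /=; rewrite -big_split.
by apply: eq_bigr => i _; rewrite mulrDl.
Qed.

Fact fps_one_neq0 : fpsC 1 != fps_zero.
Proof.
by apply/eqP => /(congr1 (fun f => fps_coef f 0)) /eqP; rewrite /= oner_eq0.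
Qed.

HB.instance Definition _ := GRing.Zmodule_isComNzRing.Build (fps R)
  fps_mulA fps_mulC fps_mul1 fps_mulDl fps_one_neq0.

(* [fps_inv_seq f n] lists the first n+1 coefficients of 1/f. *)
Fixpoint fps_inv_seq f n : seq R :=
  if n is m.+1 then
    let s := fps_inv_seq f m in
    rcons s (- (fps_coef f 0)^-1 *
               \sum_(i < m.+1) fps_coef f i.+1 * s`_(m - i))
  else [:: (fps_coef f 0)^-1].

Definition fps_unit : pred (fps R) :=
  [pred f | fps_coef f 0 \is a GRing.unit].

Definition fps_inv f : fps R :=
  if fps_unit f then Fps (fun n => (fps_inv_seq f n)`_n) else f.

Fact size_fps_inv_seq f n : size (fps_inv_seq f n) = n.+1.
Proof. by elim: n => //= n IHn; rewrite size_rcons IHn. Qed.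

Fact nth_fps_inv_seq f m n : (n <= m)%N ->
  (fps_inv_seq f m)`_n = (fps_inv_seq f n)`_n.
Proof.
elim: m => [|m IHm]; first by rewrite leqn0 => /eqP->.
rewrite leq_eqVlt => /orP[/eqP->//|]; rewrite ltnS => nm.
by rewrite /= nth_rcons size_fps_inv_seq ltnS nm IHm.
Qed.

Fact fps_mulV : {in fps_unit, left_inverse 1 fps_inv *%R}.
Proof.
move=> f fU; rewrite mulrC; apply: fps_ext => n.
have f0 : fps_coef f 0 \is a GRing.unit by [].
rewrite /fps_inv ifT //= big_ord_recl subn0 /=.
case: n => [|n] /=; first by rewrite big_ord0 addr0 divrr.
rewrite nth_rcons size_fps_inv_seq ltnn eqxx mulrA mulrN divrr // mulN1r.
rewrite addrC; apply/eqP; rewrite subr_eq0; apply/eqP/eq_bigr => i _.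
by rewrite /= subSS [in RHS]nth_fps_inv_seq // leq_subr.
Qed.

Fact fps_unitP f g : g * f = 1 -> f \in fps_unit.
Proof.
move=> /(congr1 (fun h => fps_coef h 0)) /=.
rewrite big_ord1 subn0 => gf; apply/unitrP.
by exists (fps_coef g 0); split; rewrite // mulrC.
Qed.

Fact fps_inv_out : {in [predC fps_unit], fps_inv =1 id}.
Proof. by move=> f fU; rewrite /fps_inv ifN. Qed.

HB.instance Definition _ := GRing.ComNzRing_hasMulInverse.Build (fps R)
  fps_mulV fps_unitP fps_inv_out.

Lemma fps_coefD f g n : fps_coef (f + g) n = fps_coef f n + fps_coef g n.
Proof. by []. Qed.

Lemma fps_coefN f n : fps_coef (- f) n = - fps_coef f n.
Proof. by []. Qed.

Lemma fps_coef1 n : fps_coef 1 n = (n == 0%N)%:R.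
Proof. by case: n. Qed.

Lemma fps_coefM f g n :
  fps_coef (f * g) n = \sum_(i < n.+1) fps_coef f i * fps_coef g (n - i).
Proof. by []. Qed.

Lemma fps_unitE f : (f \is a GRing.unit) = (fps_coef f 0 \is a GRing.unit).
Proof. by []. Qed.

Definition fpsX : fps R := Fps (fun n => (n == 1%N)%:R).

(* The series a_1 y + a_2 y^2 + ...; the value of [a] at 0 is irrelevant. *)
Definition fps_sum1 (a : nat -> R) : fps R :=
  Fps (fun d => if d == 0%N then 0 else a d).

End FpsRing.

Arguments fpsX {R}.

Local Close Scope ring_scope.

(* One-line notation of permutations as words on positive integers. *)
Definition order_iso (s t : seq nat) : bool :=
  (size s == size t) &&
  [forall i : 'I_(size s), forall j : 'I_(size s),
    (nth 0 s i < nth 0 s j) == (nth 0 t i < nth 0 t j)].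

Definition contains (p w : seq nat) : bool :=
  [exists m : (size w).-tuple bool, order_iso (mask m w) p].

Definition avoids_all (P : seq (seq nat)) (w : seq nat) : bool :=
  all (fun p => ~~ contains p w) P.

Definition des (w : seq nat) : nat :=
  #|[set i : 'I_(size w).-1 | nth 0 w i > nth 0 w i.+1]|.

(* The diamond on 'I_v: 0 is the least element, v-1 the greatest, and
   1, ..., v-2 are the middle elements from left to right. *)
Definition diamond_lt (v : nat) (a b : 'I_v) : bool :=
  (val a == 0) && (val b != 0) || (val a != v.-1) && (val b == v.-1).

(* [D (i, a)] encodes the label of element a of the i-th diamond, shifted by
   one: ordinals start at 0, labels at 1. *)
Definition labelling (v d : nat) := {ffun 'I_d * 'I_v -> 'I_(v * d)}.

Definition label (v d : nat) (D : labelling v d) (i : 'I_d) (a : 'I_v) : nat :=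
  (D (i, a)).+1.

(* Injectivity means that each of the v * d labels is used exactly once. *)
Definition is_diamond_labelling (v d : nat) (D : labelling v d) : bool :=
  injectiveb D &&
  [forall i : 'I_d, forall a : 'I_v, forall b : 'I_v,
    diamond_lt a b ==> (label D i a < label D i b)].

Definition diamond_perm (v d : nat) (D : labelling v d) : seq nat :=
  [seq label D i a | i <- enum 'I_d, a <- enum 'I_v].

Definition diamonds (v d : nat) (P : seq (seq nat)) : {set labelling v d} :=
  [set D | is_diamond_labelling D & avoids_all P (diamond_perm D)].

(* The field Q(x) of rational functions and its indeterminate x. *)
Definition ratfun : fieldType := {fraction {poly rat}}.
Definition ratfunX : ratfun := tofrac 'X%R.

(* Main.v *)
Require Import Defs.
From HB Require Import structures.
From mathcomp Require Import all_boot all_order all_algebra.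
From mathcomp Require Import zify ring.
From mathcomp Require Import boolp.

(** The permutations avoiding 231 and 312 are the layered ones: increasing
    sequences of decreasing runs. Such a permutation is determined by its
    descent set, which is arbitrary. The first (last) element of a diamond is
    its least (greatest) label exactly when the layered permutation has no
    descent right after (right before) it. Of the [v d - 1] positions this
    forbids [2 d], so the labellings of [d >= 1] diamonds correspond to the
    subsets of a set of [(v - 2) d - 1] positions and the coefficient of [y^d]
    is [(1 + x)^((v - 2) d - 1)]. *)

(** * Occurrences of 231 and 312 as triples of positions *)

Lemma order_iso231 (a b c : nat) :
  order_iso [:: a; b; c] [:: 2; 3; 1] = (c < a < b).
Proof.
rewrite /order_iso /=; apply/idP/idP => [/forallP H|/andP[ca ab]].
  move: (H (inord 0)) => /forallP/(_ (inord 1)); rewrite !inordK //= => ab.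
  move: (H (inord 2)) => /forallP/(_ (inord 0)); rewrite !inordK //= => ca.
  lia.
apply/forallP => -[[|[|[|//]]] ?]; apply/forallP => -[[|[|[|//]]] ?] /=; lia.
Qed.

Lemma order_iso312 (a b c : nat) :
  order_iso [:: a; b; c] [:: 3; 1; 2] = (b < c < a).
Proof.
rewrite /order_iso /=; apply/idP/idP => [/forallP H|/andP[bc ca]].
  move: (H (inord 1)) => /forallP/(_ (inord 2)); rewrite !inordK //= => bc.
  move: (H (inord 2)) => /forallP/(_ (inord 0)); rewrite !inordK //= => ca.
  lia.
apply/forallP => -[[|[|[|//]]] ?]; apply/forallP => -[[|[|[|//]]] ?] /=; lia.
Qed.

Lemma sorted_ltn_subseq_iota (s : seq nat) (n : nat) :
  sorted ltn s -> all (gtn n) s -> subseq s (iota 0 n).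
Proof.
move=> s_sorted /allP s_lt.
have -> : s = [seq k <- iota 0 n | k \in s].
  apply: (irr_sorted_eq ltn_trans ltnn) => //.
    exact: sorted_filter ltn_trans _ _ (iota_ltn_sorted _ _).
  move=> k; rewrite mem_filter mem_iota add0n leq0n /=.
  by case: (boolP (k \in s)) => //= /s_lt /= ->.
exact: filter_subseq.
Qed.

(** A mask applied to [iota 0 (size w)] instead of [w] selects positions, hence an increasing
    triple; conversely such a triple is a subsequence of that list and gives back a mask. *)
Lemma contains3P (p1 p2 p3 : nat) (w : seq nat) :
  reflect (exists i j k, i < j < k /\ k < size w /\
             order_iso [:: nth 0 w i; nth 0 w j; nth 0 w k] [:: p1; p2; p3])
          (contains [:: p1; p2; p3] w).
Proof.
have w_iota : [seq nth 0 w k | k <- iota 0 (size w)] = w.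
  by rewrite map_nth_iota0 // take_size.
apply: (iffP existsP) => [[m iso]|[i [j [k [ijk [kn iso]]]]]].
  set s := mask m (iota 0 (size w)).
  have ws : mask m w = [seq nth 0 w k | k <- s] by rewrite map_mask w_iota.
  have s_sorted : sorted ltn s.
    by apply: (subseq_sorted ltn_trans) (mask_subseq _ _) (iota_ltn_sorted _ _).
  have s_lt : {in s, forall k, k < size w}.
    by move=> k /mem_mask; rewrite mem_iota.
  have : size s = 3 by move: iso => /andP[/eqP]; rewrite ws size_map.
  case: s ws s_sorted s_lt => [|i [|j [|k [|? ?]]]] //= ws ijk s_lt _.
  exists i, j, k; rewrite andbT in ijk; rewrite -[_ :: _]ws ijk; split=> //.
  by split=> //; apply: s_lt; rewrite !inE eqxx !orbT.
have sub : subseq [:: i; j; k] (iota 0 (size w)).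
  by apply: sorted_ltn_subseq_iota; rewrite /= ?andbT //; lia.
case/subseqP: sub => m sm em.
have szm : size m == size w by rewrite sm size_iota.
exists (Tuple szm).
by rewrite /= -[w in mask _ w]w_iota -map_mask -em.
Qed.

Lemma avoids_231_312P (w : seq nat) :
  reflect (forall i j k, i < j < k -> k < size w ->
             ~~ (nth 0 w k < nth 0 w i < nth 0 w j) /\
             ~~ (nth 0 w j < nth 0 w k < nth 0 w i))
          (avoids_all [:: [:: 2; 3; 1]; [:: 3; 1; 2]] w).
Proof.
rewrite /avoids_all /= andbT.
apply: (iffP andP) => [[av1 av2] i j k ijk kn|av].
  split; [move: av1 | move: av2]; apply: contraNN => lt; apply/contains3P;
    by exists i, j, k; rewrite ?order_iso231 ?order_iso312.
split; apply/contains3P => -[i [j [k [ijk [kn]]]]];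
  rewrite ?order_iso231 ?order_iso312; apply/negP;
  by have [] := av i j k ijk kn.
Qed.

(** * Layered permutations with a prescribed descent set *)

(** Counting the ascents before position [i] gives the index of the decreasing run that contains
    it. *)
Fixpoint layer (s : pred nat) (i : nat) : nat :=
  if i is k.+1 then layer s k + ~~ s k else 0.

Lemma layer_homo (s : pred nat) : {homo layer s : i j / i <= j}.
Proof.
apply: homo_leq => [//|j i k|i /=]; [exact: leq_trans | exact: leq_addr].
Qed.

Lemma eq_layer (s t : pred nat) (i : nat) :
  (forall k, k < i -> s k = t k) -> layer s i = layer t i.
Proof.
by elim: i => //= i IH st; rewrite st // IH // => k ki; apply/st/ltnW.
Qed.

Lemma layer_const (s : pred nat) (i j k : nat) :
  layer s i = layer s j -> i <= k < j -> s k.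
Proof.
move=> ij /andP[ik kj]; move: (layer_homo s _ _ ik) (layer_homo s _ _ kj) => /=.
by rewrite ij; case: (s k) => //=; lia.
Qed.

Lemma layer_jump (s : pred nat) (i j : nat) :
  layer s i < layer s j -> exists2 k, i <= k < j & ~~ s k.
Proof.
move=> lij; apply: contraPP lij => nk; apply/negP; rewrite -leqNgt.
elim: j nk => //= j IH nk.
have [ij|ji] := leqP i j; last exact: (layer_homo s j.+1 i).
have -> : s j by apply: contra_notT nk => sj; exists j; rewrite ?ij ?ltnSn.
rewrite addn0; apply: IH => -[k kij sk]; apply: nk; exists k => //; lia.
Qed.

(* Order of the values of the layered permutation with descent set [s]: the
   layers increase from left to right and each of them is decreasing. *)
Definition layered_lt (s : pred nat) (i j : nat) : bool :=
  (layer s i < layer s j) || (layer s i == layer s j) && (j < i).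

Lemma layered_lt_irr s i : layered_lt s i i = false.
Proof. by rewrite /layered_lt; lia. Qed.

Lemma layered_lt_trans s : transitive (layered_lt s).
Proof. by move=> j i k; rewrite /layered_lt; lia. Qed.

Lemma layered_lt_total s i j : i != j -> layered_lt s i j || layered_lt s j i.
Proof. by rewrite /layered_lt; lia. Qed.

(** At a position below [n], [layer] reads [s] only below [n.-1], the range of possible descents. *)
Lemma eq_layered_lt (s t : pred nat) (n i j : nat) :
  (forall k, k < n.-1 -> s k = t k) -> i < n -> j < n ->
  layered_lt s i j = layered_lt t i j.
Proof.
move=> st lti ltj; rewrite /layered_lt !(eq_layer s t) // => k ?;
  by apply: st; lia.
Qed.

Lemma layered_lt_succ (s : pred nat) (k : nat) : layered_lt s k.+1 k = s k.
Proof. by rewrite /layered_lt /=; case: (s k); lia. Qed.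

(** In both patterns the last value lies below the first, so [i] and [k] share a layer, which then
    contains [j]; but a layer is decreasing, whereas each pattern has an ascent between adjacent
    entries. *)
Lemma layered_lt_avoids (s : pred nat) (i j k : nat) : i < j < k ->
  ~~ (layered_lt s k i && layered_lt s i j) /\
  ~~ (layered_lt s j k && layered_lt s k i).
Proof.
move=> /andP[ij jk]; have := layer_homo s _ _ (ltnW ij).
by have := layer_homo s _ _ (ltnW jk); rewrite /layered_lt; lia.
Qed.

(** * Permutations avoiding both patterns are layered *)

Section Avoiders.

Variables (n : nat) (f : nat -> nat).
Hypothesis f_inj : forall i j, i < n -> j < n -> f i = f j -> i = j.
Hypothesis f_av : forall i j k, i < j < k -> k < n ->
  ~~ (f k < f i < f j) /\ ~~ (f j < f k < f i).

Let s : pred nat := fun k => f k.+1 < f k.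

(* An ascent at [k], [i <= k < j], inside an inversion of [i] and [j] would give
   231 on [i, k+1, j] or 312 on [i, k, k+1]. *)
Lemma avoider_layered_lt (i j : nat) : i < n -> j < n ->
  (f i < f j) = layered_lt s i j.
Proof.
have sub a b : a < n -> b < n -> layered_lt s a b -> f a < f b.
  move=> an bn /orP[lab|/andP[/eqP lab ba]].
    have ab : a < b.
      rewrite ltnNge; apply: contraL lab; rewrite -leqNgt; exact: layer_homo.
    have [k kab] := layer_jump _ _ _ lab; rewrite /s -leqNgt => fk.
    rewrite ltnNge; apply/negP => fba.
    have fk' : f k != f k.+1 by apply/eqP => /f_inj; lia.
    have fab : f a != f b by apply/eqP => /f_inj; lia.
    have [ek|ak] : a = k \/ a < k by lia.
      have kb : k.+1 < b.
        by case: (ltngtP k.+1 b) => // [|ekb]; [lia | subst; lia].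
      by subst a; case: (f_av k k.+1 b); lia.
    have fak : f a != f k.+1 by apply/eqP => /f_inj; lia.
    have [fka|fka] := leqP (f k.+1) (f a); first by case: (f_av a k k.+1); lia.
    have kb : k.+1 < b.
      by case: (ltngtP k.+1 b) => // [|ekb]; [lia | subst; lia].
    by case: (f_av a k.+1 b); lia.
  (* Within one layer every step from [b] up to [a] is a descent; they are chained by induction on
     [a]. *)
  elim: a an ba lab => // a IH an ba lab.
  have sa : s a by apply: (layer_const s b a.+1) => //; lia.
  have [->|ba'] : b = a \/ b < a by lia.
    exact: sa.
  have fa : f a < f b.
    by apply: IH; [lia | done | move: lab; rewrite /= sa addn0].
  by move: sa; rewrite /s => sa; apply: ltn_trans sa fa.
(* Since [layered_lt] is total, the inclusion [sub] already forces the converse. *)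
move=> lti ltj; apply/idP/idP => [fij|]; last exact: sub.
have ij : i != j by apply/eqP => e; rewrite e ltnn in fij.
case/orP: (layered_lt_total s i j ij) => // /(sub _ _ ltj lti); lia.
Qed.

End Avoiders.

(** * Indices in the reading word, and labels as ranks *)

Lemma nth_allpairs (S T U : Type) (x0 : S) (y0 : T) (z0 : U)
    (f : S -> T -> U) (s : seq S) (t : seq T) (i j : nat) :
  i < size s -> j < size t ->
  nth z0 [seq f x y | x <- s, y <- t] (i * size t + j)
    = f (nth x0 s i) (nth y0 t j).
Proof.
move=> + jt; elim: s i => // x s IH [|i] /= si.
  by rewrite nth_cat size_map mul0n add0n jt (nth_map y0).
rewrite nth_cat size_map ifN; last by rewrite mulSn -leqNgt -addnA leq_addr.
by rewrite mulSn -addnA addKn IH.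
Qed.

(** By cardinality [F] is a bijection, so every value below [F q] is taken exactly once. Hence a
    labelling is recovered from the order of its labels. *)
Lemma card_rank (T : finType) (n : nat) (F : T -> 'I_n) (q : T) :
  injective F -> n <= #|T| -> #|[set r | F r < F q]| = F q.
Proof.
move=> F_inj nT; have F_bij : bijective F.
  by apply: inj_card_bij; rewrite ?card_ord.
have -> : [set r | F r < F q] = F @^-1: [set k : 'I_n | k < F q].
  by apply/setP => r; rewrite !inE.
rewrite on_card_preimset; last exact: onW_bij.
rewrite -sum1dep_card -[RHS]card_ord -sum1_card.
by rewrite (big_ord_widen n (fun=> 1) (ltnW (ltn_ord (F q)))).
Qed.

(** * Labellings of diamonds and their descent sets *)

Section Labellings.

Variables (v d : nat).
Implicit Types (q r : 'I_d * 'I_v) (D : labelling v d).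

Definition pos q : nat := q.1 * v + q.2.

Lemma pos_lt q : pos q < v * d.
Proof.
case: q => [[i id] [a av]]; rewrite /pos /=.
apply: (@leq_trans (i.+1 * v)); first by rewrite mulSn; lia.
by rewrite mulnC leq_mul2l id orbT.
Qed.

Lemma pos_inj : injective pos.
Proof.
case=> [[i id] [a av]] [[j jd] [b bv]]; rewrite /pos /= => e.
have v0 : 0 < v by exact: leq_ltn_trans av.
have ij : i = j.
  by move: (congr1 (divn^~ v) e); rewrite !divnMDl // !divn_small // !addn0.
subst j; have ab : a = b by lia.
by subst b; congr (_, _); apply: val_inj.
Qed.

Lemma pos_surj t : t < v * d -> exists q, pos q = t.
Proof.
move=> tn; have v0 : 0 < v by case: (v) tn.
have td : t %/ v < d by rewrite ltn_divLR // mulnC.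
have tv : t %% v < v by rewrite ltn_mod.
by exists (Ordinal td, Ordinal tv); rewrite /pos /= -divn_eq.
Qed.

Lemma size_diamond_perm D : size (diamond_perm D) = v * d.
Proof. by rewrite size_allpairs !size_enum_ord mulnC. Qed.

Lemma nth_diamond_perm D q : nth 0 (diamond_perm D) (pos q) = (D q).+1.
Proof.
case: q => i a; rewrite /pos /= -[v in _ * v]size_enum_ord.
rewrite (nth_allpairs _ _ _ i a) ?size_enum_ord //.
by rewrite !nth_ord_enum.
Qed.

Lemma nth_diamond_perm_inj D i j : injective D -> i < v * d -> j < v * d ->
  nth 0 (diamond_perm D) i = nth 0 (diamond_perm D) j -> i = j.
Proof.
move=> D_inj /pos_surj[q <-] /pos_surj[r <-].
by rewrite !nth_diamond_perm => -[/val_inj/D_inj->].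
Qed.

Definition descents D : {set 'I_(v * d).-1} :=
  [set k : 'I_(v * d).-1 |
    nth 0 (diamond_perm D) k.+1 < nth 0 (diamond_perm D) k].

Lemma des_diamond_perm D : des (diamond_perm D) = #|descents D|.
Proof.
by rewrite /des -!sum1dep_card size_diamond_perm.
Qed.

(** Extends a set of ordinals by false to all naturals, the form that [layer] takes. *)
Definition nat_mem m (B : {set 'I_m}) : pred nat :=
  fun k => k \in [seq val j | j in B].

Lemma nat_memE m (B : {set 'I_m}) (k : 'I_m) : nat_mem m B k = (k \in B).
Proof. by rewrite /nat_mem mem_map ?mem_enum //; apply: val_inj. Qed.

(** The descent predicate in [avoider_layered_lt] agrees with [nat_mem] below [(v * d).-1], which
    suffices for positions in the word. *)
Lemma diamond_labelling_lt D :
  D \in diamonds v d [:: [:: 2; 3; 1]; [:: 3; 1; 2]] ->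
  forall q r, (D q < D r) = layered_lt (nat_mem _ (descents D)) (pos q) (pos r).
Proof.
rewrite inE => /andP[/andP[/injectiveP D_inj _] /avoids_231_312P av] q r.
rewrite size_diamond_perm in av.
have D_lt := avoider_layered_lt _ _ (fun i j => nth_diamond_perm_inj D i j D_inj) av.
have := D_lt _ _ (pos_lt q) (pos_lt r).
rewrite !nth_diamond_perm ltnS => ->.
apply: eq_layered_lt (pos_lt q) (pos_lt r) => k kn.
by rewrite -[k in RHS]/(val (Ordinal kn)) nat_memE inE.
Qed.

(** Each label is a rank for an order that depends only on the descent set. *)
Lemma descents_inj :
  {in diamonds v d [:: [:: 2; 3; 1]; [:: 3; 1; 2]] &, injective descents}.
Proof.
move=> D E Dd Ed DE; apply/ffunP => q; apply: val_inj.
have rank F : F \in diamonds v d [:: [:: 2; 3; 1]; [:: 3; 1; 2]] ->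
    F q = #|[set r | layered_lt (nat_mem _ (descents F)) (pos r) (pos q)]| :> nat.
  move=> Fd; have F_inj : injective F.
    by move: Fd; rewrite inE => /andP[/andP[/injectiveP]].
  rewrite -(card_rank _ _ F q F_inj); last by rewrite card_prod !card_ord mulnC.
  by congr #|pred_of_set _|; apply/setP => r; rewrite !inE diamond_labelling_lt.
by rewrite /= !rank // DE.
Qed.

Lemma layered_rank_lt (s : pred nat) q :
  #|[set r | layered_lt s (pos r) (pos q)]| < v * d.
Proof.
have -> : v * d = #|[set: 'I_d * 'I_v]|.
  by rewrite cardsT card_prod !card_ord mulnC.
apply: proper_card; apply/properP; split; first exact: subsetT.
by exists q; rewrite ?inE // layered_lt_irr.
Qed.

(** Labels are the ranks, from 0, in the order [layered_lt]; this provides the inverse of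
    [descents]. *)
Definition layered_labelling (s : pred nat) : labelling v d :=
  [ffun q => Ordinal (layered_rank_lt s q)].

Lemma layered_labelling_lt s q r :
  (layered_labelling s q < layered_labelling s r) = layered_lt s (pos q) (pos r).
Proof.
have sub a b : layered_lt s (pos a) (pos b) ->
    layered_labelling s a < layered_labelling s b.
  move=> ab; rewrite !ffunE /=; apply/proper_card/properP; split.
    by apply/subsetP => c; rewrite !inE => ca; apply: layered_lt_trans ca ab.
  by exists a; rewrite !inE ?layered_lt_irr.
apply/idP/idP => [lt|]; last exact: sub.
have qr : pos q != pos r by apply: contraTneq lt => /pos_inj->; rewrite ltnn.
by case/orP: (layered_lt_total s _ _ qr) => // /sub; lia.
Qed.

Lemma layered_labelling_inj s : injective (layered_labelling s).
Proof.
move=> q r e; apply: pos_inj; apply: contraTeq isT => qr.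
by case/orP: (layered_lt_total s _ _ qr); rewrite -layered_labelling_lt e ltnn.
Qed.

Lemma descents_layered_labelling (B : {set 'I_(v * d).-1}) :
  descents (layered_labelling (nat_mem _ B)) = B.
Proof.
apply/setP => k; rewrite inE -nat_memE -[RHS]layered_lt_succ.
have [q qk] : exists q, pos q = k by apply: pos_surj; have := ltn_ord k; lia.
have [r rk] : exists r, pos r = k.+1 by apply: pos_surj; have := ltn_ord k; lia.
by rewrite -rk -qk !nth_diamond_perm ltnS layered_labelling_lt.
Qed.

(** * Descent sets compatible with the diamond order *)

Hypothesis v_gt1 : 1 < v.

(** Excluded are the positions right after a least element and right before a greatest one; those
    between consecutive diamonds, with [k %% v] equal to [v - 1], stay free. *)
Definition free_positions : {set 'I_(v * d).-1} :=
  [set k : 'I_(v * d).-1 | (k %% v != 0) && (k %% v != v - 2)].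

Lemma descents_free D :
  is_diamond_labelling D -> descents D \subset free_positions.
Proof.
move=> /andP[_ /forallP Dlt]; apply/subsetP => k; rewrite !inE -negb_or.
apply: contraTN => k_mod; rewrite -leqNgt.
have kn : k < v * d by have := ltn_ord k; lia.
have kv : k %% v < v by rewrite ltn_mod; lia.
have kv1 : (k %% v).+1 < v by lia.
have kd : k %/ v < d by rewrite ltn_divLR ?mulnC //; lia.
have -> : k = pos (Ordinal kd, Ordinal kv) :> nat by rewrite /pos /= -divn_eq.
have -> : (pos (Ordinal kd, Ordinal kv)).+1 = pos (Ordinal kd, Ordinal kv1).
  by rewrite /pos /= addnS.
rewrite !nth_diamond_perm ltnW //.
move: (Dlt (Ordinal kd)) => /forallP/(_ (Ordinal kv))/forallP/(_ (Ordinal kv1)).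
by rewrite /diamond_lt /label /= => /implyP; apply; lia.
Qed.

(** The ascent right after a least element puts it in a strictly lower layer than the rest of its
    diamond; the ascent right before a greatest element acts symmetrically. *)
Lemma layered_labelling_diamonds (B : {set 'I_(v * d).-1}) :
  B \subset free_positions ->
  layered_labelling (nat_mem _ B) \in
    diamonds v d [:: [:: 2; 3; 1]; [:: 3; 1; 2]].
Proof.
move=> /subsetP Bfree; set s := nat_mem _ B; rewrite inE; apply/andP; split.
  apply/andP; split; first by apply/injectiveP; exact: layered_labelling_inj.
  have asc k : (k %% v == 0) || (k %% v == v - 2) -> layer s k < layer s k.+1.
    rewrite /= => k_mod; suff -> : ~~ s k by rewrite addn1.
    apply: contraL k_mod => /mapP[j]; rewrite mem_enum => /Bfree + ->.
    by rewrite inE negb_or.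
  apply/forallP => i; apply/forallP => a; apply/forallP => b; apply/implyP => ab.
  rewrite /label ltnS layered_labelling_lt /layered_lt; apply/orP; left.
  have av := ltn_ord a; have bv := ltn_ord b; rewrite /pos /=.
  case/orP: ab => /andP[]; rewrite /= => ea eb.
    apply: (leq_trans (asc _ _)); last first.
      by apply: layer_homo; lia.
    by rewrite (eqP ea) addn0 modnMl.
  apply: (@leq_ltn_trans (layer s (i * v + (v - 2)))).
    by apply: layer_homo; lia.
  apply: (leq_trans (asc _ _)); last by apply: layer_homo; lia.
  by rewrite modnMDl modn_small ?eqxx ?orbT //; lia.
apply/avoids_231_312P => i j k ijk; rewrite size_diamond_perm => kn.
have [q qi] : exists q, pos q = i by apply: pos_surj; lia.
have [r rj] : exists r, pos r = j by apply: pos_surj; lia.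
have [t tk] : exists t, pos t = k by apply: pos_surj; lia.
rewrite -qi -rj -tk !nth_diamond_perm !ltnS !layered_labelling_lt qi rj tk.
exact: layered_lt_avoids.
Qed.

Lemma descents_imset :
  descents @: diamonds v d [:: [:: 2; 3; 1]; [:: 3; 1; 2]]
    = powerset free_positions.
Proof.
apply/setP => B; rewrite powersetE; apply/imsetP/idP => [[D + ->]|Bfree].
  by rewrite inE => /andP[/descents_free].
by exists (layered_labelling (nat_mem _ B));
  rewrite ?layered_labelling_diamonds ?descents_layered_labelling.
Qed.

(** Each block of [v] consecutive indices has [v - 2] good ones. The last index of all is good but
    has no successor in the word, whence the [- 1]. *)
Lemma card_free_positions : 2 < v -> 0 < d ->
  #|free_positions| = (v - 2) * d - 1.
Proof.
move=> v_gt2 d_gt0; pose good k := (k %% v != 0) && (k %% v != v - 2).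
have count_row i : \sum_(i * v <= k < i.+1 * v) good k = v - 2.
  rewrite -[i * v]add0n big_addn mulSn addnK.
  under eq_big_nat => k kv do rewrite /good addnC modnMDl modn_small //.
  (* Offsets [v - 1], [v - 2] and 0 are split off; all those in between are good. *)
  have -> : v = (v - 3).+3 by lia.
  rewrite big_nat_recr // big_nat_recr // big_nat_recl //=.
  rewrite (eq_big_nat _ _ (F2 := fun=> 1)) => [|k kv]; last by lia.
  by rewrite sum_nat_const_nat; lia.
have count_all e : \sum_(0 <= k < e * v) good k = (v - 2) * e.
  elim: e => [|e IH]; first by rewrite mul0n muln0 big_nil.
  rewrite (@big_cat_nat _ _ _ (e * v)) //=; last by rewrite leq_mul2r leqnSn orbT.
  by rewrite IH count_row mulnS addnC.
rewrite -sum1dep_card big_mkcond /=.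
have -> : \sum_(k < (v * d).-1) (if good k then 1 else 0)
    = \sum_(0 <= k < (v * d).-1) good k.
  by rewrite big_mkord; apply: eq_bigr => k _; case: (good k).
have := count_all d; rewrite [d * v]mulnC.
have vd0 : 0 < v * d by rewrite muln_gt0; lia.
rewrite -{1}(prednK vd0) big_nat_recr //=.
have -> : good (v * d).-1.
  have -> : (v * d).-1 = d.-1 * v + v.-1 by nia.
  by rewrite /good modnMDl modn_small; lia.
by move=> <-; rewrite addnK.
Qed.

End Labellings.

(** * Descent polynomial for [d] diamonds *)

Import GRing.Theory.
Local Open Scope ring_scope.

(** Factors 1 outside [A] let the product run over all of [T]; in its expansion the terms of sets
    not contained in [A] have a factor 0. *)
Lemma sum_powerset_expr (R : comNzRingType) (T : finType) (A : {set T})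
    (x : R) :
  \sum_(B in powerset A) x ^+ #|B| = (1 + x) ^+ #|A|.
Proof.
have -> : (1 + x) ^+ #|A| = \prod_i ((if i \in A then x else 0) + 1).
  rewrite -prodr_const big_mkcond; apply: eq_bigr => i _.
  by case: ifP; rewrite ?add0r // addrC.
rewrite bigA_distr big_mkcond; apply: eq_bigr => B _.
rewrite -big_mkcond powersetE; case: ifPn => [/subsetP BA|/subsetPn[i iB iA]].
  by rewrite -prodr_const; apply: eq_bigr => i /BA ->.
by rewrite (bigD1 i) //= (negPf iA) mul0r.
Qed.

(** The sum is reindexed along [descents], a bijection onto the subsets of [free_positions]. *)
Lemma sum_diamonds_des (R : comNzRingType) (v d : nat) (x : R) :
  (2 < v)%N -> (0 < d)%N ->
  \sum_(D in diamonds v d [:: [:: 2; 3; 1]%N; [:: 3; 1; 2]%N])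
    x ^+ des (diamond_perm D) = (1 + x) ^+ ((v - 2) * d - 1).
Proof.
move=> v_gt2 d_gt0; under eq_bigr => D _ do rewrite des_diamond_perm.
rewrite -(big_imset (fun B : {set _} => x ^+ #|B|) (@descents_inj v d)) /=.
rewrite descents_imset ?sum_powerset_expr ?card_free_positions //; lia.
Qed.

(** * Constants and the geometric series *)

Section FormalPowerSeries.

Variable R : comUnitRingType.
Implicit Types (a b : R) (f : fps R).

Lemma fpsCD a b : fpsC (a + b) = fpsC a + fpsC b.
Proof. by apply: fps_ext => -[|n] /=; rewrite ?addr0. Qed.

Lemma fps_coefCM a f n : fps_coef (fpsC a * f) n = a * fps_coef f n.
Proof.
rewrite fps_coefM big_ord_recl /= subn0 big1 ?addr0 // => i _.
by rewrite mul0r.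
Qed.

Lemma fpsCM a b : fpsC (a * b) = fpsC a * fpsC b.
Proof.
by apply: fps_ext => n; rewrite fps_coefCM /=; case: n => //= n; rewrite mulr0.
Qed.

Lemma fpsCX a n : fpsC (a ^+ n) = fpsC a ^+ n.
Proof. by elim: n => // n IH; rewrite !exprS fpsCM IH. Qed.

Lemma fps_coefXM f n :
  fps_coef (fpsX * f) n = if n is m.+1 then fps_coef f m else 0.
Proof.
rewrite fps_coefM; case: n => [|n]; first by rewrite big_ord1 mul0r.
rewrite !big_ord_recl /= mul0r add0r mul1r subn1 big1 ?addr0 // => i _.
by rewrite mul0r.
Qed.

Lemma fps_geometric a : Fps (fun n => a ^+ n) * (1 - fpsX * fpsC a) = 1.
Proof.
rewrite mulrBr mulr1 mulrCA [_ * fpsC a]mulrC; apply: fps_ext => n.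
rewrite fps_coefD fps_coefN fps_coefXM fps_coef1.
by case: n => [|n]; rewrite ?subr0 // fps_coefCM /= exprS subrr.
Qed.

End FormalPowerSeries.

(** * Closed form of the generating function *)

Lemma ratfunX1_neq0 : 1 + ratfunX != 0.
Proof.
rewrite /ratfunX -tofrac1 -tofracD tofrac_eq0 addrC -[1]opprK -[- 1]polyCN.
by rewrite polyXsubC_eq0.
Qed.

Theorem theorem3p10 (v : nat) (hv : (4 <= v)%N) :
  let x : fps ratfun := fpsC ratfunX in
  let y : fps ratfun := fpsX in
  1 + fps_sum1 (fun d : nat =>
        \sum_(D in diamonds v d [:: [:: 2; 3; 1]%N; [:: 3; 1; 2]%N])
          ratfunX ^+ des (diamond_perm D))
  = (1 + x - y * x * (1 + x) ^+ (v - 2))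
    / ((1 + x) * (1 - y * (1 + x) ^+ (v - 2))).
Proof.
move=> x y; set F := 1 + _; set A := (1 + x) ^+ (v - 2).
pose alpha := (1 + ratfunX) ^+ (v - 2).
have A_const : A = fpsC alpha by rewrite /A /alpha fpsCX fpsCD.
(* The factor [1 + x] raises the exponent [(v - 2) * d - 1] to [(v - 2) * d], giving [alpha ^+ d] in
   degree [d > 0]; the term [x] corrects degree 0, where the coefficient is [1 + ratfunX]. *)
have FG : (1 + x) * F = x + Fps (fun n => alpha ^+ n).
  rewrite -[1 + x]fpsCD; apply: fps_ext => d.
  rewrite fps_coefCM !fps_coefD fps_coef1 /=.
  case: d => [|d] /=; first by rewrite addr0 mulr1 addrC.
  rewrite !add0r sum_diamonds_des //; last by lia.
  rewrite -exprS /alpha -exprM; congr (_ ^+ _); nia.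
(* A series is invertible when its constant coefficient is, here [1 + ratfunX]. *)
have unit_den : (1 + x) * (1 - y * A) \is a GRing.unit.
  rewrite fps_unitE fps_coefM big_ord1 /= big_ord1 /= mul0r subr0 mulr1 unitfE.
  exact: ratfunX1_neq0.
apply: (canRL (mulrK unit_den)).
(* The geometric series cancels against [1 - y * A], leaving [x * (1 - y * A) + 1]. *)
rewrite mulrA [F * _]mulrC FG mulrDl A_const fps_geometric.
by rewrite -A_const; ring.
Qed.
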